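(* Let $\boldsymbol\Upsilon=(\gamma^{ij})_{1\le i,j\le 3}$ be the (positive definite) inverse of the spatial 3-metric at a given spacetime point, and let the equation of state satisfy the assumptions (E0)-(E3) listed in the context. Then the admissible state set $$\mathcal G=\Big\{\mathbf U=(D,\mathbf m,E)^\top \ \Big|\ \rho(\mathbf U)>0,\ p(\mathbf U)>0,\ e(\mathbf U)>0,\ v(\mathbf U)<1\Big\}$$ is equal to the set $$\mathcal G_\gamma=\Big\{\mathbf U=(D,\mathbf m,E)^\top\ \Big|\ D>0,\ q_\gamma(\mathbf U)>0\Big\},\qquad q_\gamma(\mathbf U):=E-\sqrt{D^2+\mathbf m\boldsymbol\Upsilon\mathbf m^\top}.$$
   Context: Latin indices run from 1 to 3 and repeated indices are summed. $(\gamma_{ij})$ is a real symmetric positive definite $3\times3$ matrix (the 3-metric at a given spacetime point), with inverse $(\gamma^{ij})$; indices are raised and lowered with them. Vectors $\mathbf m=(m_1,m_2,m_3)\in\mathbb R^3$ and $\mathbf v=(v_1,v_2,v_3)\in\mathbb R^3$ are row vectors of covariant components, so $m_jm^j=\mathbf m\boldsymbol\Upsilon\mathbf m^\top$. States are $\mathbf U=(D,\mathbf m,E)^\top\in\mathbb R^5$. Equation of state (EOS): a function $e=e(p,\rho)$ (specific internal energy as a function of pressure and rest-mass density), with specific enthalpy $h(p,\rho)=1+e(p,\rho)+p/\rho$, such that for all $p,\rho>0$: (E0) $e$ is continuously differentiable on $(0,\infty)\times(0,\infty)$; (E1) $h(p,\rho)\ge\sqrt{1+p^2/\rho^2}+p/\rho$;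 (E2) $h\left(\frac1\rho-\frac{\partial h}{\partial p}\right)<\frac{\partial h}{\partial\rho}<0$; (E3) for each fixed $\rho>0$, $\lim_{p\to0^+}e(p,\rho)=0$ and $\lim_{p\to+\infty}e(p,\rho)=+\infty$. Conservative variables in terms of primitive variables $(\rho,\mathbf v,p)$: with $v=\sqrt{\gamma^{ij}v_iv_j}<1$ and Lorentz factor $w=(1-v^2)^{-1/2}$, $$D=\rho w,\qquad \mathbf m=\rho h w^2\mathbf v,\qquad E=\rho h w^2-p .$$ Meaning of $\mathcal G$: $\mathbf U\in\mathcal G$ means that $\mathbf U$ is given by these formulas for some primitive variables with $\rho>0$, $p>0$, $e(p,\rho)>0$, $v<1$; these are denoted $\rho(\mathbf U),p(\mathbf U),\mathbf v(\mathbf U)$, $e(\mathbf U)=e(p(\mathbf U),\rho(\mathbf U))$. Equivalently, $p(\mathbf U)>0$ solves $E+p=D\,h\big(p,\rho^{[\mathbf U]}(p)\big)\big(1-\tfrac{m_jm^j}{(E+p)^2}\big)^{-1/2}$ with $\rho^{[\mathbf U]}(p)=D\sqrt{1-m_jm^j/(E+p)^2}$, and then $v_j=m_j/(E+p)$, $\rho=D\sqrt{1-v_jv^j}$. *)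

(* Defs.v *)
From HB Require Import structures.
From mathcomp Require Import all_boot all_order all_algebra.
From mathcomp Require Import all_classical all_reals all_analysis.
Set Implicit Arguments.
Unset Strict Implicit.
Unset Printing Implicit Defensive.
Import Order.TTheory GRing.Theory Num.Theory.
Import numFieldNormedType.Exports.
Local Open Scope classical_set_scope.
Local Open Scope ring_scope.

Section Metric.
Variable R : realType.

(* x A x^T; for A = (gamma^{ij}) and a row vector x of covariant components
   this is the contraction x_j x^j. *)
Definition quad n (A : 'M[R]_n) (x : 'rV[R]_n) : R := (x *m A *m x^T) 0 0.

Definition sym_posdef n (A : 'M[R]_n) : Prop :=
  A^T = A /\ forall x : 'rV[R]_n, x != 0 -> 0 < quad A x.

End Metric.

Section EquationOfState.
Variable R : realType.

(* Meant for open A. As R * R is finite dimensional, continuity of the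
   differential y |-> 'd f y amounts to its continuity on every vector u. *)
Definition continuously_differentiable_on (A : set (R * R)) (f : R * R -> R) :=
  forall x, A x -> differentiable f x /\
    forall u : R * R, {for x, continuous (fun y => 'd f y u)}.

Definition quadrant : set (R * R) := [set x | 0 < x.1 /\ 0 < x.2].

(* An equation of state is a function e of (pressure, rest-mass density), in
   this order; only its values at positive arguments are ever relevant. *)
Definition enthalpy (e : R -> R -> R) (p rho : R) : R := 1 + e p rho + p / rho.

Definition dpressure (f : R -> R -> R) (p rho : R) : R :=
  derive1 (fun p' => f p' rho) p.

Definition ddensity (f : R -> R -> R) (p rho : R) : R :=
  derive1 (fun rho' => f p rho') rho.

Record eos_assumptions (e : R -> R -> R) : Prop := {
  eos_C1 : continuously_differentiable_on quadrant (fun x => e x.1 x.2) ;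
  eos_enthalpy_ge : forall p rho : R, 0 < p -> 0 < rho ->
    enthalpy e p rho >= Num.sqrt (1 + p ^+ 2 / rho ^+ 2) + p / rho ;
  eos_enthalpy_deriv : forall p rho : R, 0 < p -> 0 < rho ->
    enthalpy e p rho * (1 / rho - dpressure (enthalpy e) p rho)
      < ddensity (enthalpy e) p rho /\
    ddensity (enthalpy e) p rho < 0 ;
  eos_lim0 : forall rho : R, 0 < rho -> e p rho @[p --> 0^'+] --> 0 ;
  eos_limy : forall rho : R, 0 < rho -> e p rho @[p --> +oo] --> +oo }.

End EquationOfState.

Section States.
Variable R : realType.

(* Conservative states (D, m, E) in R^5; m is covariant. *)
Record state := State { dens : R ; mom : 'rV[R]_3 ; energy : R }.

Variables (e : R -> R -> R) (Upsilon : 'M[R]_3).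

Definition speed (v : 'rV[R]_3) : R := Num.sqrt (quad Upsilon v).

Definition lorentz (v : 'rV[R]_3) : R := (Num.sqrt (1 - speed v ^+ 2))^-1.

Definition conservative (rho : R) (v : 'rV[R]_3) (p : R) : state :=
  let w := lorentz v in
  let h := enthalpy e p rho in
  State (rho * w) ((rho * h * w ^+ 2) *: v) (rho * h * w ^+ 2 - p).

(* The primitive variables of U are defined only implicitly, as a physical
   preimage of U under the map conservative. *)
Definition admissible : set state :=
  [set U | exists (rho : R) (v : 'rV[R]_3) (p : R),
     U = conservative rho v p /\
     [/\ 0 < rho, 0 < p, 0 < e p rho & speed v < 1] ].

Definition q_gamma (U : state) : R :=
  energy U - Num.sqrt (dens U ^+ 2 + quad Upsilon (mom U)).

Definition admissible_gamma : set state :=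
  [set U | 0 < dens U /\ 0 < q_gamma U].

End States.

(* Main.v *)
(* Every conservative state satisfies the bound: (E1) gives
   [h - p/rho >= sqrt(1 + p^2/rho^2)], which is exactly what makes
   [E^2 - D^2 - m.m >= p^2].
   Conversely, with [M = m.m] and [T p = sqrt ((E + p)^2 - M)], a pressure is
   recovered from U exactly when it is a zero of [D h(p, rho p) - T p], where
   [rho p = D T p / (E + p)]. This function is nonnegative at [p = E], by (E1).
   Near [p = 0] it is negative: [rho] is nondecreasing and [h] is nonincreasing
   in the density (E2), so [D h(p, rho p) <= D h(p, rho 0)], which tends to
   [D < T 0 <= T p] by (E3). The intermediate value theorem concludes, and
   [e > 0] follows from (E1). *)
Require Import Defs.
From HB Require Import structures.
From mathcomp Require Import all_boot all_order all_algebra.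
From mathcomp Require Import all_classical all_reals all_analysis.
From mathcomp Require Import ring lra.
Import Order.TTheory GRing.Theory Num.Theory.
Import numFieldNormedType.Exports.
Local Open Scope classical_set_scope.
Local Open Scope ring_scope.

Section QuadraticForm.
Variable R : realType.

Lemma quadZ n (A : 'M[R]_n) (c : R) (x : 'rV[R]_n) :
  quad A (c *: x) = c ^+ 2 * quad A x.
Proof.
by rewrite /quad -!scalemxAl linearZ /= -scalemxAr !mxE mulrA -expr2.
Qed.

Lemma quad_trmx n (A : 'M[R]_n) (x : 'rV[R]_n) : quad A^T x = quad A x.
Proof.
rewrite /quad.
have -> : x *m A^T *m x^T = (x *m A *m x^T)^T.
  by rewrite !trmx_mul trmxK mulmxA.
by rewrite mxE.
Qed.

Lemma sym_posdef_quad_ge0 n (A : 'M[R]_n) (x : 'rV[R]_n) :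
  sym_posdef A -> 0 <= quad A x.
Proof.
case=> _ posA; have [->|/posA/ltW//] := eqVneq x 0.
by rewrite /quad !mul0mx mxE.
Qed.

Lemma sym_posdef_unitmx n (A : 'M[R]_n) : sym_posdef A -> A \in unitmx.
Proof.
case=> _ posA; rewrite unitmxE unitfE; apply/det0P => -[x xn0 xA].
by have := posA x xn0; rewrite /quad xA mul0mx mxE ltxx.
Qed.

(** With y = x A^-1 one has y A y^T = x (A^-1)^T x^T, and transposing its matrix leaves a quadratic
    form unchanged. *)
Lemma sym_posdef_quad_invmx_ge0 n (A : 'M[R]_n) (x : 'rV[R]_n) :
  sym_posdef A -> 0 <= quad (invmx A) x.
Proof.
move=> pA; suff -> : quad (invmx A) x = quad A (x *m invmx A).
  exact: sym_posdef_quad_ge0.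
rewrite -quad_trmx /quad mulmxKV ?sym_posdef_unitmx //.
by rewrite trmx_mul mulmxA.
Qed.

End QuadraticForm.

Section EquationOfStateFacts.
Variables (R : realType) (e : R -> R -> R).
Hypothesis he : eos_assumptions e.

Lemma eos_energy_gt0 (p rho : R) : 0 < p -> 0 < rho -> 0 < e p rho.
Proof.
move=> p0 r0; have := eos_enthalpy_ge he p0 r0; rewrite /enthalpy lerD2r.
suff : 1 < Num.sqrt (1 + p ^+ 2 / rho ^+ 2) by lra.
rewrite -[ltLHS]sqrtr1 ltr_sqrt; first by rewrite ltrDl divr_gt0 ?exprn_gt0.
by rewrite addr_gt0 ?divr_gt0 ?exprn_gt0.
Qed.

(** Multiplied by [rho], (E1) reads rho h - p >= sqrt (rho^2 + p^2) > 0; squaring removes the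
    root. *)
Lemma eos_enthalpy_quadratic (p rho : R) : 0 < p -> 0 < rho ->
  p < rho * enthalpy e p rho /\
  rho ^+ 2 + p ^+ 2 <= (rho * enthalpy e p rho - p) ^+ 2.
Proof.
move=> p0 r0; have := eos_enthalpy_ge he p0 r0; set h := enthalpy e p rho.
set s := Num.sqrt _ => hs.
have rn0 : rho != 0 by rewrite gt_eqF.
have sE : rho * (s + p / rho) = rho * s + p by field.
have s2 : (rho * s) ^+ 2 = rho ^+ 2 + p ^+ 2.
  rewrite exprMn sqr_sqrtr; first by field.
  by rewrite addr_ge0 // divr_ge0 ?exprn_ge0 // ltW.
have sgt0 : 0 < rho * s.
  by rewrite mulr_gt0 // sqrtr_gt0 addr_gt0 ?divr_gt0 ?exprn_gt0.
have le_rsh : rho * s + p <= rho * h by rewrite -sE ler_pM2l.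
split; first by lra.
by rewrite -s2 ler_sqr ?nnegrE; lra.
Qed.

Lemma eos_enthalpy_ge2 (p rho : R) : 0 < p -> 0 < rho ->
  2 * p <= rho * enthalpy e p rho.
Proof.
move=> p0 r0; have [hp hq] := eos_enthalpy_quadratic p rho p0 r0.
suff : p <= rho * enthalpy e p rho - p by lra.
by rewrite -ler_sqr ?nnegrE; [have := exprn_gt0 2 r0; lra|lra|lra].
Qed.

(** The density derivative is negative by (E2); composing (E0) with r |-> (p, r) supplies the
    differentiability. *)
Lemma eos_enthalpy_nincr (p rho1 rho2 : R) : 0 < p -> 0 < rho1 ->
  rho1 <= rho2 -> enthalpy e p rho2 <= enthalpy e p rho1.
Proof.
move=> p0 r10 r12.
have dh (r : R) : 0 < r -> derivable (enthalpy e p) r 1.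
  move=> r0; apply: derivableD; last first.
    apply: derivableM => //; apply: derivableV => //.
    by rewrite gt_eqF.
  apply: derivableD => //; apply/derivable1_diffP.
  apply: (@differentiable_comp _ _ _ _ (fun r : R => (p, r))
    (fun x : R * R => e x.1 x.2)).
    by apply: differentiable_pair.
  by have [] := @eos_C1 _ _ he (p, r) (conj p0 r0).
apply: (@ler0_derive1_le_cc _ (enthalpy e p) rho1 rho2) => //.
- by move=> x; rewrite in_itv /= => /andP[/(lt_trans r10)/dh].
- move=> x; rewrite in_itv /= => /andP[/(lt_trans r10) x0 _].
  by have [_ /ltW] := eos_enthalpy_deriv he p0 x0.
- apply: continuous_in_subspaceT => x; rewrite inE /= in_itv /= => /andP[+ _].
  move=> /(lt_le_trans r10)/dh /derivable1_diffP.
  exact: differentiable_continuous.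
- by rewrite in_itv /= r12 lexx.
- by rewrite in_itv /= lexx r12.
Qed.

Lemma eos_enthalpy_cvg1 (rho : R) : 0 < rho ->
  enthalpy e p rho @[p --> 0^'+] --> (1 : R).
Proof.
move=> r0; rewrite -[X in _ --> X]addr0 -[X in _ --> X + _]addr0.
apply: cvgD; first by apply: cvgD; [exact: cvg_cst|exact: eos_lim0].
rewrite -[X in _ --> X](mul0r rho^-1); apply: cvgM; last exact: cvg_cst.
exact/cvg_at_right_filter/cvg_id.
Qed.

(** In the recovery equation the density moves with the pressure, which calls for the joint
    continuity contained in (E0). *)
Lemma eos_enthalpy_continuous (g : R -> R) (p : R) : 0 < p -> 0 < g p ->
  {for p, continuous g} -> {for p, continuous (fun p => enthalpy e p (g p))}.
Proof.
move=> p0 gp0 cg; apply: cvgD; last first.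
  by apply: cvgM; [exact: cvg_id|apply: cvgV => //; rewrite gt_eqF].
apply: cvgD; first exact: cvg_cst.
have [/differentiable_continuous ce _] := @eos_C1 _ _ he (p, g p) (conj p0 gp0).
apply: (@continuous_comp _ _ _ (fun p => (p, g p))
  (fun x : R * R => e x.1 x.2)) ce.
exact: (cvg_pair (@cvg_id _ (nbhs p)) cg).
Qed.

(** [M] stands for m_j m^j. The equation is E + p = D h w divided by the Lorentz factor w = (E + p)
    / T, with T = sqrt ((E + p)^2 - M). *)
Lemma eos_pressure_recovery (D M E : R) : 0 < D -> 0 <= M -> 0 < E ->
  D ^+ 2 + M < E ^+ 2 ->
  exists2 p : R, 0 < p &
    D * enthalpy e p (D * Num.sqrt ((E + p) ^+ 2 - M) / (E + p)) =
    Num.sqrt ((E + p) ^+ 2 - M).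
Proof.
move=> D0 M0 E0 DME.
pose T p := Num.sqrt ((E + p) ^+ 2 - M).
pose r p := D * T p / (E + p).
have D20 : 0 < D ^+ 2 by rewrite exprn_gt0.
have sqE (p : R) : 0 <= p -> E ^+ 2 <= (E + p) ^+ 2.
  by move=> p0; rewrite ler_sqr ?nnegrE; lra.
have T2 (p : R) : 0 <= p -> T p ^+ 2 = (E + p) ^+ 2 - M.
  by move=> p0; rewrite sqr_sqrtr //; have := sqE p p0; lra.
have Tgt (p : R) : 0 <= p -> 0 < T p.
  by move=> p0; rewrite sqrtr_gt0; have := sqE p p0; lra.
have Tge (p : R) : 0 <= p -> 0 <= T p by move/Tgt/ltW.
have rgt (p : R) : 0 <= p -> 0 < r p.
  by move=> p0; rewrite divr_gt0 ?mulr_gt0 ?Tgt //; lra.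
have T0le (p : R) : 0 <= p -> T 0 <= T p.
  move=> p0; rewrite -ler_sqr ?nnegrE ?Tge // !T2 // addr0.
  by have := sqE p p0; lra.
have T0D : D < T 0.
  by rewrite -ltr_sqr; [rewrite T2 //; lra|exact: ltW|exact: Tge].
have r0le (p : R) : 0 <= p -> r 0 <= r p.
  move=> p0; have Ep : 0 < E + p by lra.
  (* Clearing denominators and squaring leaves M E^2 <= M (E + p)^2. *)
  rewrite /r addr0 ler_pdivrMr // mulrAC ler_pdivlMr // -!mulrA ler_pM2l //.
  rewrite -ler_sqr; [|exact: mulr_ge0 (Tge _ _) (ltW Ep)|
    exact: mulr_ge0 (Tge _ p0) (ltW E0)].
  rewrite !exprMn !T2 // addr0.
  by have := ler_wpM2l M0 (sqE p p0); lra.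
have cr (p : R) : 0 <= p -> {for p, continuous T} /\ {for p, continuous r}.
  move=> p0; have cE : {for p, continuous (fun p => E + p)}.
    by apply: cvgD; [exact: cvg_cst|exact: cvg_id].
  have cT : {for p, continuous T}.
    apply: (@continuous_comp _ _ _ (fun p => (E + p) ^+ 2 - M) Num.sqrt).
      by apply: cvgB; [apply: cvgM|exact: cvg_cst].
    exact: sqrt_continuous.
  split=> //; apply: cvgM; first by apply: cvgM => //; exact: cvg_cst.
  by apply: cvgV => //; rewrite gt_eqF //; lra.
(* (E3) is a limit at fixed density, so the density is frozen at [r 0]. The bound [p0 < E] orders
   the endpoints of the interval used below. *)
have [p0 [p00 p0E hp0]] : exists p0 : R,
    [/\ 0 < p0, p0 < E & D * enthalpy e p0 (r 0) < T 0].
  have h1 : 1 < T 0 / D by rewrite ltr_pdivlMr // mul1r.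
  have := cvgr_lt _ (@eos_enthalpy_cvg1 (r 0) (rgt 0 (lexx 0))) _ h1 => hlt.
  near (0:R)^'+ => p; exists p; split.
  - by near: p; exact: nbhs_right_gt.
  - by near: p; exact: nbhs_right_lt.
  - by rewrite mulrC -ltr_pdivlMr //; near: p; exact: hlt.
pose g p := D * enthalpy e p (r p) - T p.
have [p /[!in_itv]/= /andP[pp0 _] gp0] : exists2 p, p \in `[p0, E] & g p = 0.
  apply: IVT; first exact: ltW.
    apply: continuous_in_subspaceT => x; rewrite inE /= in_itv /= => /andP[xp _].
    have x0 : 0 < x by exact: lt_le_trans xp.
    have [cT crx] := cr x (ltW x0).
    apply: cvgB => //; apply: cvgM; first exact: cvg_cst.
    by apply: eos_enthalpy_continuous => //; exact/rgt/ltW.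
  rewrite ge_min le_max; apply/andP; split; apply/orP; [left|right].
    rewrite subr_le0; apply: le_trans (T0le p0 (ltW p00)).
    apply: le_trans (ltW hp0); rewrite ler_pM2l //.
    by apply: eos_enthalpy_nincr => //; [exact: rgt|exact/r0le/ltW].
  (* Since r E * 2E = D * T E, the bound 2E <= r E * h becomes (2E)^2 <= T E * (D * h), while (T
     E)^2 = (2E)^2 - M. *)
  have TE := Tgt E (ltW E0).
  rewrite subr_ge0 -(ler_pM2l TE) -expr2 T2; last exact: ltW.
  have := @eos_enthalpy_ge2 E (r E) E0 (rgt E (ltW E0)).
  have rE : r E * (2 * E) = D * T E by rewrite /r; field; lra.
  move/(ler_wpM2l (ltW (addr_gt0 E0 E0))).
  have -> : (E + E) * (r E * enthalpy e E (r E)) =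
            T E * (D * enthalpy e E (r E)) by rewrite [RHS]mulrA [T E * D]mulrC -rE; ring.
  by lra.
exists p; first exact: lt_le_trans pp0.
by move/eqP: gp0; rewrite subr_eq0 => /eqP.
Unshelve. all: by end_near.
Qed.

End EquationOfStateFacts.

Theorem lemma1 (R : realType) (gamma : 'M[R]_3) (e : R -> R -> R)
    (hgamma : sym_posdef gamma) (he : eos_assumptions e) :
  admissible e (invmx gamma) = admissible_gamma (invmx gamma).
Proof.
have Uge0 x : 0 <= quad (invmx gamma) x by exact: sym_posdef_quad_invmx_ge0.
apply/seteqP; split => [U [rho [v [p [-> [r0 p0 _ v1]]]]]|[D m E] []]; last first.
  rewrite /q_gamma /= subr_gt0 => D0 qE; set M := quad (invmx gamma) m in qE.
  have M0 : 0 <= M by exact: Uge0.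
  have E0 : 0 < E by apply: le_lt_trans qE; exact: sqrtr_ge0.
  have DM : D ^+ 2 + M < E ^+ 2.
    move: qE; rewrite -ltr_sqr ?nnegrE ?sqrtr_ge0 ?ltW // sqr_sqrtr //.
    by rewrite addr_ge0 // sqr_ge0.
  have [p p0] := eos_pressure_recovery R e he D M E D0 M0 E0 DM.
  set T := Num.sqrt _; set rho := D * T / (E + p) => hT.
  have Ep : 0 < E + p by lra.
  have EM : 0 < (E + p) ^+ 2 - M.
    have : E ^+ 2 <= (E + p) ^+ 2 by rewrite ler_sqr ?nnegrE; lra.
    by have := exprn_gt0 2 D0; lra.
  have T0 : 0 < T by rewrite sqrtr_gt0.
  have T2 : T ^+ 2 = (E + p) ^+ 2 - M by rewrite sqr_sqrtr // ltW.
  have r0 : 0 < rho by rewrite divr_gt0 ?mulr_gt0.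
  (* The velocity is m / (E + p) because m = rho h w^2 v and rho h w^2 = E + p; then T / (E + p) is
     1 / w. *)
  have v2 : quad (invmx gamma) ((E + p)^-1 *: m) = 1 - (T / (E + p)) ^+ 2.
    by rewrite quadZ -/M; rewrite [(T / _) ^+ 2]exprMn T2; field; lra.
  have wE : lorentz (invmx gamma) ((E + p)^-1 *: m) = (E + p) / T.
    rewrite /lorentz /speed sqr_sqrtr // v2 opprB addrC subrK.
    by rewrite sqrtr_sqr gtr0_norm ?divr_gt0 // invf_div.
  exists rho, ((E + p)^-1 *: m), p; split; last first.
    split => //; first exact: eos_energy_gt0.
    rewrite /speed -[ltRHS]sqrtr1 ltr_sqrt // v2 gtrBl exprn_gt0 //.
    exact: divr_gt0.
  have hw : rho * enthalpy e p rho * ((E + p) / T) ^+ 2 = E + p.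
    have -> : enthalpy e p rho = T / D by rewrite -hT mulrC mulKf ?gt_eqF.
    by rewrite /rho; field; rewrite !gt_eqF.
  rewrite /conservative wE hw scalerA mulfV ?gt_eqF // scale1r addrK.
  by congr State; rewrite /rho; field; rewrite !gt_eqF.
(* Bound for a state given by primitive variables: below, [x] is v^2, [s] is 1 / w and [a] is rho h
   w^2 = E + p. *)
have {v1} : quad (invmx gamma) v < 1.
  by move: v1; rewrite /speed -[ltRHS]sqrtr1 ltr_sqrt.
rewrite /admissible_gamma /q_gamma /conservative /= quadZ.
rewrite /lorentz /speed sqr_sqrtr //; have := Uge0 v.
set x := quad _ _ => x0 x1; set h := enthalpy e p rho.
set s := Num.sqrt _.
have s0 : 0 < s by rewrite sqrtr_gt0 subr_gt0.
have s2 : s ^+ 2 = 1 - x by rewrite sqr_sqrtr // subr_ge0 ltW.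
have [hp hq] := eos_enthalpy_quadratic R e he p rho p0 r0.
split; first by rewrite mulr_gt0 ?invr_gt0.
rewrite subr_gt0; set a := rho * h * s^-1 ^+ 2.
have aE : rho * h = a * s ^+ 2 by rewrite /a; field; rewrite gt_eqF.
have s21 : s ^+ 2 <= 1 by lra.
(* This is E > 0, so that E and the square root can be compared through their squares. *)
have pa : p < a.
  apply: (lt_le_trans hp); rewrite -/h aE ler_piMr // /a.
  by rewrite mulr_ge0 ?sqr_ge0 //; exact: ltW (lt_trans p0 hp).
rewrite -[ltRHS]gtr0_norm ?subr_gt0 // -sqrtr_sqr ltr_sqrt; last first.
  by rewrite exprn_gt0 ?subr_gt0.
have -> : (rho * s^-1) ^+ 2 = rho ^+ 2 / s ^+ 2 by field; rewrite gt_eqF.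
(* With x = 1 - s^2 the goal becomes rho^2 < (a s^2 - p)^2 - p^2 + p^2 s^2. [hq] bounds rho^2 by the
   first two terms, and p^2 s^2 > 0 makes the inequality strict. *)
rewrite -ltrBrDr ltr_pdivrMr ?exprn_gt0 //.
move: hq; rewrite -/h aE.
have -> : x = 1 - s ^+ 2 by lra.
by have := mulr_gt0 (exprn_gt0 2 p0) (exprn_gt0 2 s0); lra.
Qed.
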